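(* Let $M=(E,\mathcal{B})$ be a connected matroid whose base polytope $B(M)$ is 2-level, obtained as a 2-sum of uniform matroids $U_1=U_{n_1,k_1},\dots,U_t=U_{n_t,k_t}$, and let $T(N,A)$ be the tree structure of $M$, with node set $N=\{U_1,\dots,U_t\}$ and edge set $A$. For each $a\in A$, let $C_a^1,C_a^2$ be the two connected components of $T$ after removal of $a$, and for $i\in\{1,2\}$ let $E_a^i$ be the set of elements of $E$ that belong to the ground set of some uniform matroid in $C_a^i$. Then $B(M)$ is the set of all $x\in\mathbb{R}^E$ such that $$x\geq 0,\qquad x\leq 1,\qquad x(E)=\mathrm{rk}(E),$$ $$x(F)\leq \mathrm{rk}(F)\quad\text{for every } F=E_a^i \text{ with } i\in\{1,2\},\ a\in A.$$ Moreover, if $F=E_a^i$ for some $i\in\{1,2\}$ and $a\in A$, then $$\mathrm{rk}(F)=1-|C_a^i|+\sum_{j:\,U_j\in C_a^i}k_j,$$ where $|C_a^i|$ is the number of nodes of $C_a^i$.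
   Context: A polytope $P$ is 2-level if for each facet $F$ of $P$ all vertices of $P$ not in $F$ lie in one common translate of the affine hull of $F$. A matroid $M=(E,\mathcal{B})$ is given by its ground set and its set of bases; $\mathrm{rk}$ is its rank function. Its base polytope $B(M)\subseteq\mathbb{R}^E$ is the convex hull of the characteristic vectors of its bases. For $x\in\mathbb{R}^E$ and $F\subseteq E$, $x(F)=\sum_{e\in F}x_e$. $U_{n,k}$ is the uniform matroid with $n$ elements and rank $k$ (bases are all $k$-subsets). Direct sum: for matroids $M_1,M_2$ with disjoint ground sets $E_1,E_2$, $M_1\oplus M_2$ has ground set $E_1\cup E_2$ and bases $B_1\cup B_2$ with $B_i\in\mathcal{B}(M_i)$. 2-sum: if $E_1\cap E_2=\{p\}$ with $p$ neither a loop nor a coloop of $M_1$ or $M_2$, $M_1\oplus_2M_2$ has ground set $(E_1\cup E_2)\setminus\{p\}$ and bases $(B_1\cup B_2)\setminus\{p\}$ with $B_i\in\mathcal{B}(M_i)$ and $p\in B_1\triangle B_2$. A matroid is connected if it is not the direct sum of two matroids each with fewer elements; a connected matroid is 3-connected if it is not the 2-sum of two matroids both with strictly fewer elements. Tree structure: every connected matroid $M$ admits 3-connected matroids $M_1,\dots,M_t$ and a tree $T$ with $t$ nodes labeled $M_1,\dots,M_t$ and edges labeled $e_1,\dots,e_{t-1}$ such that (1) $E(M)\cap\{e_1,\dots,e_{t-1}\}=\emptyset$ and $E(M_1)\cup\dots\cup E(M_t)=E(M)\cup\{e_1,\dots,e_{t-1}\}$; (2) if edge $e_i$ joins $M_{j_1}$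 and $M_{j_2}$ then $E(M_{j_1})\cap E(M_{j_2})=\{e_i\}$; (3) if no edge joins $M_{j_1}$ and $M_{j_2}$ (with $j_1\ne j_2$) then $E(M_{j_1})\cap E(M_{j_2})=\emptyset$; and $M$ is the matroid labeling the single node left after contracting $e_1,\dots,e_{t-1}$ one by one in order, where on contracting $e_i$ the merged node is labeled by the 2-sum of the matroids that labeled the two ends of $e_i$. In the statement, $T(N,A)$ is such a tree for $M$ with the 3-connected matroids $M_j$ being the uniform matroids $U_j$. *)

(* Defs.v *)
From HB Require Import structures.
From mathcomp Require Import all_boot all_order all_algebra.

Set Implicit Arguments.
Unset Strict Implicit.
Unset Printing Implicit Defensive.

Import Order.TTheory GRing.Theory Num.Theory.

Local Open Scope ring_scope.

(** * Matroids *)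

(* The ground set is a subset of an ambient finite type V, so that matroids
   with overlapping ground sets can be combined. *)
Definition matroid_axioms (V : finType) (E : {set V}) (Bs : {set {set V}}) :=
  [&& Bs != set0,
      [forall B in Bs, B \subset E] &
      [forall B1 in Bs, forall B2 in Bs, forall x in B1 :\: B2,
        exists y in B2 :\: B1, (y |: (B1 :\ x)) \in Bs]].

Record matroid (V : finType) := Matroid {
  ground : {set V};
  bases : {set {set V}};
  matroidP : matroid_axioms ground bases
}.

Section Matroids.
Variable V : finType.
Implicit Types (M N : matroid V) (F : {set V}) (p : V).

Definition independent M F := [exists B in bases M, F \subset B].

Definition rk M F : nat :=
  (\max_(I : {set V} | (I \subset F) && independent M I) #|I|)%N.

Definition loop M p := (p \in ground M) && [forall B in bases M, p \notin B].
Definition coloop M p := (p \in ground M) && [forall B in bases M, p \in B].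

Definition is_uniform M (n k : nat) : Prop :=
  #|ground M| = n /\
  bases M = [set B : {set V} | (B \subset ground M) && (#|B| == k)].

Definition is_direct_sum M M1 M2 : Prop :=
  [/\ [disjoint ground M1 & ground M2],
      ground M = ground M1 :|: ground M2 &
      bases M = [set B1 :|: B2 | B1 in bases M1, B2 in bases M2]].

Definition is_two_sum M M1 M2 : Prop :=
  exists p,
  [/\ ground M1 :&: ground M2 = [set p],
      ~~ loop M1 p /\ ~~ coloop M1 p,
      ~~ loop M2 p /\ ~~ coloop M2 p,
      ground M = (ground M1 :|: ground M2) :\ p &
      bases M = [set (B1 :|: B2) :\ p | B1 in bases M1, B2 in bases M2
                  & (p \in B1) (+) (p \in B2)]].

Definition matroid_connected M : Prop :=
  ~ exists M1 M2, [/\ is_direct_sum M M1 M2,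
      (#|ground M1| < #|ground M|)%N & (#|ground M2| < #|ground M|)%N].

End Matroids.

Section Lift.
Variables (V : finType) (M : matroid V).

Definition lift_ground : {set option V} := Some @: ground M.
Definition lift_bases : {set {set option V}} :=
  [set Some @: (B : {set V}) | B in bases M].

Lemma lift_axioms : matroid_axioms lift_ground lift_bases.
Proof.
have /and3P [ne /forall_inP sub /forall_inP exch] := matroidP M.
have Sinj : injective (@Some V) by move=> x y [].
apply/and3P; split.
- by have [B BM] := set0Pn _ ne; apply/set0Pn; exists (Some @: B); apply: imset_f.
- apply/forall_inP => _ /imsetP [B BM ->].
  by apply: imsetS; apply: sub.
- apply/forall_inP => _ /imsetP [B1 B1M ->].
  apply/forall_inP => _ /imsetP [B2 B2M ->].
  apply/forall_inP => _ /setDP [/imsetP [x xB1 ->]].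
  rewrite mem_imset // => xB2.
  have /forall_inP /(_ _ B2M) /forall_inP /(_ x) := exch _ B1M.
  rewrite !inE xB1 xB2 => /(_ isT) /exists_inP [y /setDP [yB2 yB1] yM].
  apply/exists_inP; exists (Some y); first by rewrite !inE !mem_imset // yB1.
  apply/imsetP; exists (y |: (B1 :\ x)) => //.
  apply/setP => -[z|]; rewrite !inE.
    by rewrite !mem_imset // !inE.
  by rewrite /=; apply/idP/imsetP => [/imsetP [z _]|[z _]].
Qed.

Definition lift_matroid : matroid (option V) := Matroid lift_axioms.

End Lift.

(* The matroids in a 2-sum have an element p outside the ground set of M, and
   V may contain no such element.  M is therefore viewed over option V, where
   None is always available as p. *)
Definition three_connected (V : finType) (M : matroid V) : Prop :=
  matroid_connected M /\
  ~ exists M1 M2 : matroid (option V), [/\ is_two_sum (lift_matroid M) M1 M2,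
      (#|ground M1| < #|ground M|)%N & (#|ground M2| < #|ground M|)%N].

(** * Trees *)

(* A graph with nodes 'I_t and edges 'I_t.-1, listed in contraction order;
   ends a is the set of the two ends of the edge a, and label a is an element
   of V. *)
Record edge_labeled_graph (V : finType) (t : nat) := EdgeLabeledGraph {
  ends : 'I_t.-1 -> {set 'I_t};
  label : 'I_t.-1 -> V
}.

Section Trees.
Variables (V : finType) (t : nat) (T : edge_labeled_graph V t).

(* adjacency in the subgraph with all the nodes and the edges in A *)
Definition adj (A : {set 'I_t.-1}) : rel 'I_t :=
  fun j1 j2 => [exists a in A, ends T a == [set j1; j2]].

Definition simple_graph : Prop := (forall a, #|ends T a| = 2) /\ injective (ends T).

Definition is_tree : Prop :=
  [/\ (0 < t)%N, simple_graph,
      forall j1 j2, connect (adj setT) j1 j2 &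
      forall c : seq 'I_t, ucycle (adj setT) c -> (size c <= 2)%N].

Definition component (A : {set 'I_t.-1}) (j : 'I_t) : {set 'I_t} :=
  [set j' | connect (adj A) j j'].

Definition components_without (a : 'I_t.-1) : {set {set 'I_t}} :=
  [set component [set~ a] j | j : 'I_t].

(* After the contraction of the edges b < a, the nodes of the resulting tree
   are the components of the graph formed by these edges.  L assigns to each
   such component its label. *)
Definition contracts_to (N : 'I_t -> matroid V) (M : matroid V) : Prop :=
  exists L : {set 'I_t} -> matroid V,
  [/\ forall j, L [set j] = N j,
      forall (a : 'I_t.-1) (j1 j2 : 'I_t), ends T a = [set j1; j2] ->
        let C1 := component [set b : 'I_t.-1 | (b < a)%N] j1 in
        let C2 := component [set b : 'I_t.-1 | (b < a)%N] j2 in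
        is_two_sum (L (C1 :|: C2)) (L C1) (L C2) &
      L setT = M].

Definition tree_structure (M : matroid V) (N : 'I_t -> matroid V) : Prop :=
  [/\ is_tree,
      forall j, three_connected (N j),
      [disjoint ground M & [set label T a | a : 'I_t.-1]] /\
      \bigcup_j ground (N j) = ground M :|: [set label T a | a : 'I_t.-1],
      (forall a j1 j2, ends T a = [set j1; j2] ->
         ground (N j1) :&: ground (N j2) = [set label T a]) /\
      (forall j1 j2, j1 != j2 -> ~~ adj setT j1 j2 ->
         [disjoint ground (N j1) & ground (N j2)]) &
      contracts_to N M].

Definition side (M : matroid V) (N : 'I_t -> matroid V) (C : {set 'I_t}) :
    {set V} :=
  [set e in ground M | [exists j in C, e \in ground (N j)]].

End Trees.

(* Imported only here because classical_sets redefines finset names such as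
   set0 and setT. *)
From mathcomp Require Import classical_sets reals.

(** * Polytopes *)

Section Polytopes.
Variables (R : realType) (W : lmodType R).
Implicit Types (S P F : set W).

Definition convex_hull S : set W := fun x =>
  exists (m : nat) (p : 'I_m -> W) (w : 'I_m -> R),
    [/\ forall i, S (p i), forall i, 0 <= w i,
        \sum_i w i = 1 & x = \sum_i w i *: p i].

Definition affine_hull S : set W := fun x =>
  exists (m : nat) (p : 'I_m -> W) (w : 'I_m -> R),
    [/\ forall i, S (p i), \sum_i w i = 1 & x = \sum_i w i *: p i].

(* The empty set is not counted as a face; taking f = 0 and b = 0 shows that
   a nonempty P is a face of itself. *)
Definition face P F : Prop :=
  (exists x, F x) /\
  exists (f : {linear W -> R^o}) (b : R),
    (forall x, P x -> f x <= b) /\ (forall x, F x <-> P x /\ f x = b).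

Definition vertex P (v : W) : Prop := face P (set1 v).

(* Facets are the inclusion-maximal faces other than P. *)
Definition facet P F : Prop :=
  [/\ face P F, F <> P &
      forall G, face P G -> G <> P -> (F `<=` G)%classic -> G = F].

(* v lies in the translate (affine hull of F) + u iff v - u lies in the affine
   hull of F. *)
Definition two_level P : Prop :=
  forall F, facet P F ->
    exists u : W, forall v, vertex P v -> ~ F v -> affine_hull F (v - u).

End Polytopes.

(** * Base polytopes *)

Section BasePolytope.
Variables (R : realType) (V : finType) (M : matroid V).

Definition elt : finType := {e : V | e \in ground M}.

Definition charvec (B : {set V}) : {ffun elt -> R^o} :=
  [ffun e => (val e \in B)%:R].

Definition base_polytope : set {ffun elt -> R^o} :=
  convex_hull (fun x => exists2 B, B \in bases M & x = charvec B).

(* x(F) *)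
Definition coord_sum (x : {ffun elt -> R^o}) (F : {set V}) : R :=
  \sum_(e : elt | val e \in F) x e.

End BasePolytope.

Arguments base_polytope R {V} M.

(* Main.v *)
Require Import Defs.
From mathcomp Require Import all_boot all_order all_algebra.
From mathcomp Require Import zify ring lra.

Set Implicit Arguments.
Unset Strict Implicit.
Unset Printing Implicit Defensive.

Import Order.TTheory GRing.Theory Num.Theory.

Local Open Scope ring_scope.

(** A point of a base polytope is the vector of marginals e |-> P(e in B) of a
    random basis B.  In a 2-sum at p the bases are the sets B1 u B2 minus p
    with p in exactly one of B1 and B2, so random bases B1 and B2 with
    P(p in B1) + P(p in B2) = 1 can be coupled to put p in exactly one of them,
    and then yield a random basis of the 2-sum with the same marginals
    (two_sum_distribution).  For a uniform matroid, every vector of [0, 1]^n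
    with sum k consists of the marginals of a random k-subset
    (uniform_marginals).  Contracting the edges of T one by one, these two facts
    show that x is in B(M) as soon as x extends to a node family: vectors z_j in
    [0, 1]^E(U_j) with sum k_j, equal to x on E, whose two values at the label
    of each edge add up to 1 (family_distribution).  Conversely every basis of M
    splits into bases of the U_j that form such a family (basis_family).

    The rest is about trees.  Remove an edge a with end i and let D be the
    nodes on the side of i, and E_D the elements of E on this side.  Summing the
    equations z_j(E(U_j)) = k_j over j in D, each of the |D| - 1 edges inside D
    contributes 1, whence
      x(E_D) = sum_(j in D) k_j - (|D| - 1) - z_i(a)      (sum_family_side).
    Since z_i(a) >= 0, with equality for some family (family_avoiding), the rank
    of E_D is sum_(j in D) k_j - (|D| - 1).  Moreover z_i(a) has to be the slack
    at x of the inequality of E_D.  Taking these slacks as a definition turns an x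
    that satisfies the inequalities into a node family (family_of_point): the
    inequalities say that the values are nonnegative, x(E) = rk(E) gives the
    value 1 at each edge, and the equation at a node i holds because the sides
    not containing i of the edges at i partition the other nodes. *)

(** * Trees *)

Section Graph.
Variables (V : finType) (t : nat) (T : edge_labeled_graph V t).
Implicit Types (A : {set 'I_t.-1}) (S : {set 'I_t}) (a b : 'I_t.-1).
Implicit Types i j : 'I_t.

Lemma adjP A i j :
  reflect (exists2 a, a \in A & ends T a = [set i; j]) (adj T A i j).
Proof. by apply: (iffP exists_inP) => -[a aA] /eqP; exists a => //; apply/eqP. Qed.

Lemma adj_sym A : symmetric (adj T A).
Proof.
move=> i j; apply/adjP/adjP => -[a aA e]; exists a => //; by rewrite e setUC.
Qed.

Lemma connect_adj_sym A : connect_sym (adj T A).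
Proof. exact/sym_connect_sym/adj_sym. Qed.

Definition stable A S :=
  forall a i j, a \in A -> ends T a = [set i; j] -> i \in S -> j \in S.

Lemma stable_connect A S i j :
  stable A S -> connect (adj T A) i j -> i \in S -> j \in S.
Proof.
move=> stS /connectP [p + ->]; elim: p i => //= k p IHp i.
by case/andP=> /adjP [a aA e] /IHp {}IHp iS; apply: IHp; apply: (stS a i).
Qed.

Lemma stable_setC A S : stable A S -> stable A (~: S).
Proof.
move=> stS a i j aA e; rewrite !inE; apply: contra.
by apply: (stS a) => //; rewrite e setUC.
Qed.

Lemma component_refl A i : i \in component T A i.
Proof. by rewrite inE connect0. Qed.

Lemma component_stable A i : stable A (component T A i).
Proof.
move=> a j j' aA e; rewrite !inE => /connect_trans; apply.
by apply: connect1; apply/adjP; exists a.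
Qed.

Lemma component_sub_stable A S i :
  stable A S -> i \in S -> component T A i \subset S.
Proof.
by move=> stS iS; apply/subsetP => j; rewrite inE => /(stable_connect stS); apply.
Qed.

Lemma component_mem A i j :
  j \in component T A i -> component T A j = component T A i.
Proof.
rewrite inE => ij; apply/setP => k; rewrite !inE.
exact/esym/(same_connect (@connect_adj_sym A)).
Qed.

Lemma component_mem_sym A i j :
  (j \in component T A i) = (i \in component T A j).
Proof. by rewrite !inE connect_adj_sym. Qed.

Lemma component_set0 i : component T set0 i = [set i].
Proof.
apply/eqP; rewrite eqEsubset sub1set component_refl andbT.
by apply: component_sub_stable; rewrite ?set11 // => a ? ?; rewrite inE.
Qed.

(** The union of the components of the two ends is stable under the new edge, and
    every other component is because it contains neither end. *)
Lemma componentU1 A a i j k : ends T a = [set i; j] ->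
  let C := component T A i :|: component T A j in
  component T (a |: A) k = if k \in C then C else component T A k.
Proof.
move=> e C.
have sub_compU l : component T A l \subset component T (a |: A) l.
  apply: component_sub_stable; last exact: component_refl.
  by move=> b ? ? bA; apply: component_stable; rewrite inE bA orbT.
have stA l : stable A (component T A l) by apply: component_stable.
have stC : stable (a |: A) C.
  move=> b i' j' /setU1P [->|bA] e'.
    move=> _; have: j' \in [set i; j] by rewrite -e e' set22.
    by rewrite /C => /set2P [] ->; rewrite in_setU component_refl ?orbT.
  by case/setUP => /(stA _ b _ _ bA e') H; rewrite in_setU H ?orbT.
case: ifP => kC; apply/eqP; rewrite eqEsubset.
  rewrite component_sub_stable //=.
  have ij : component T (a |: A) j = component T (a |: A) i.
    apply: component_mem; apply: (@component_stable _ _ a i) => //.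
      exact: setU11.
    exact: component_refl.
  have sC : C \subset component T (a |: A) i.
    by rewrite subUset sub_compU -ij sub_compU.
  by rewrite (component_mem (subsetP sC _ kC)).
rewrite sub_compU andbT; apply: component_sub_stable; last exact: component_refl.
move=> b i' j' /setU1P [->|bA] e'; last exact: (stA _ b).
move=> i'k; case/negP: (negbT kC).
have: i' \in [set i; j] by rewrite -e e' set21.
by case/set2P => E; move: i'k; rewrite E component_mem_sym /C in_setU => ->; rewrite ?orbT.
Qed.

Definition graph_connected A := forall i j, connect (adj T A) i j.

(** Induction along a search of the graph: a proper set of nodes that no edge
    leaves would be stable, which connectedness forbids. *)
Lemma grow A (P : {set 'I_t} -> Prop) S :
  graph_connected A -> S != set0 -> P S ->
  (forall S' a i j, a \in A -> ends T a = [set i; j] ->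
     i \in S' -> j \notin S' -> P S' -> P (j |: S')) ->
  P setT.
Proof.
move=> conA + + step.
have [n] := ubnP #|~: S|; elim: n S => // n IHn S cS S0 PS.
have /set0Pn [i0 i0S] := S0.
have [/exists_inP [a aA /exists_inP [i iS /exists_inP [j]]] | noex] :=
    boolP [exists a in A, exists i in S, exists j in ~: S, ends T a == [set i; j]].
  rewrite inE => jS /eqP e; apply: (IHn (j |: S)).
  - apply: leq_trans (cS : (_ <= n)%N); apply: proper_card.
    rewrite properE setCS subsetUr /=; apply/subsetPn; exists j; rewrite !inE //.
    by rewrite eqxx.
  - by apply/set0Pn; exists j; rewrite setU11.
  - exact: step e iS jS PS.
suff -> : setT = S by [].
apply/esym/eqP; rewrite eqEsubset subsetT /=; apply/subsetP => j _.
apply: stable_connect (conA i0 j) i0S => a i k aA e iS.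
apply: contraR noex => kS; apply/exists_inP; exists a => //.
apply/exists_inP; exists i => //; apply/exists_inP; exists k; rewrite ?inE //.
exact/eqP.
Qed.

Definition inner A S := [set a in A | ends T a \subset S].

Lemma inner_grow A S a i j : a \in A -> ends T a = [set i; j] ->
  i \in S -> j \notin S -> (#|inner A S| < #|inner A (j |: S)|)%N.
Proof.
move=> aA e iS jS; have a_out : a \notin inner A S.
  by rewrite inE e subUset !sub1set (negPf jS) !andbF.
have <- : #|a |: inner A S| = #|inner A S|.+1 by rewrite cardsU1 a_out.
apply/subset_leq_card/subsetP => b /setU1P [->|]; rewrite !inE.
  by rewrite aA e subUset !sub1set !inE iS eqxx orbT.
by case/andP=> -> /= /subset_trans; apply; apply: subsetUr.
Qed.

(** Growing S to the set of all nodes uses up a new edge for each new node. *)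
Lemma card_inner_connected A S : graph_connected A -> S != set0 ->
  (#|inner A S| + t <= #|A| + #|S|)%N.
Proof.
move=> conA S0.
have: (#|inner A S| + #|[set: 'I_t]| <= #|inner A setT| + #|S|)%N.
  apply: (grow (P := fun S' => (#|inner A S| + #|S'| <= #|inner A S'| + #|S|)%N)
    conA S0) => // S' a i j aA e iS jS; rewrite cardsU1 jS.
  have := inner_grow aA e iS jS; lia.
rewrite cardsT card_ord => /leq_trans; apply; rewrite leq_add2r.
by apply/subset_leq_card/subsetP => a; rewrite inE => /andP [].
Qed.

Hypothesis simpleT : forall a, #|ends T a| = 2.

Lemma endsE a i : i \in ends T a -> exists2 j, j != i & ends T a = [set i; j].
Proof.
have /eqP/cards2P [k [l [kl ->]]] := simpleT a.
case/set2P=> ->; [exists l | exists k] => //; first by rewrite eq_sym.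
by rewrite setUC.
Qed.

Lemma ends_neq a i j : ends T a = [set i; j] -> i != j.
Proof. by move=> e; have := simpleT a; rewrite e cards2; case: (i != j). Qed.

Hypothesis conT : graph_connected setT.

(** A tree has only t - 1 edges, and by the previous count a set with as many
    inner edges as nodes would leave too few of them to reach the other nodes. *)
Lemma tree_inner S : S != set0 -> (#|inner setT S| < #|S|)%N.
Proof.
move=> S0; have := card_inner_connected conT S0.
have /set0Pn [i _] := S0; have := ltn_ord i.
rewrite cardsT card_ord; lia.
Qed.

Lemma stableT_full S i : stable setT S -> i \in S -> S = setT.
Proof.
move=> stS iS; apply/eqP; rewrite eqEsubset subsetT /=; apply/subsetP => j _.
exact: stable_connect stS (conT i j) iS.
Qed.

(** Otherwise the t - 2 edges other than a would connect the t nodes. *)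
Lemma tree_bridge a i j : ends T a = [set i; j] ->
  j \notin component T [set~ a] i.
Proof.
move=> e; apply/negP => ij.
have full k : component T [set~ a] k = setT.
  have fi : component T [set~ a] i = setT.
    apply: (@stableT_full _ i); last exact: component_refl.
    move=> b k' l _ e' k'i; have [E|ba] := eqVneq b a; last first.
      by apply: component_stable e' k'i; rewrite !inE.
    have: l \in [set i; j] by rewrite -e -E e' set22.
    by case/set2P => ->; rewrite ?component_refl.
  by rewrite -fi; apply: component_mem; rewrite fi inE.
have conA : graph_connected [set~ a].
  move=> k l; have: l \in component T [set~ a] k by rewrite full inE.
  by rewrite inE.
have i0 : [set i] != set0 by apply/set0Pn; exists i; rewrite inE.
have := card_inner_connected conA i0.
rewrite cards1 cardsC1 card_ord; have := ltn_ord a; lia.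
Qed.

Lemma tree_cut a i j : ends T a = [set i; j] ->
  component T [set~ a] j = ~: component T [set~ a] i.
Proof.
move=> e; set Ci := component T _ i; set Cj := component T _ j.
have ij : j \notin Ci := tree_bridge e.
have full : Ci :|: Cj = setT.
  apply: (@stableT_full _ i); last by rewrite inE component_refl.
  move=> b k l _ e'; have [E _|ba] := eqVneq b a.
    have: l \in [set i; j] by rewrite -e -E e' set22.
    by case/set2P => ->; rewrite inE component_refl ?orbT.
  have bA : b \in [set~ a] by rewrite !inE.
  by case/setUP => /(component_stable bA e') lC; apply/setUP; [left | right].
apply/setP => k; rewrite [RHS]inE; apply/idP/idP => [kj|ki].
  apply: contra ij => ki.
  by rewrite /Ci -(component_mem ki) (component_mem kj) component_refl.
have: k \in Ci :|: Cj by rewrite full inE.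
by rewrite in_setU (negPf ki).
Qed.

(** By [tree_inner] each side has more nodes than inner edges; the two sides have
    t nodes and t - 2 inner edges in all, so both differences are exactly 1. *)
Lemma card_inner_side a i : i \in ends T a ->
  let D := component T [set~ a] i in (#|inner setT D|.+1 = #|D|)%N.
Proof.
move=> ia D; have [j ji e] := endsE ia.
have iD : i \in D by apply: component_refl.
have jD : j \in ~: D by rewrite inE tree_bridge.
have stD : stable [set~ a] D by apply: component_stable.
clearbody D.
have D0 : D != set0 by apply/set0Pn; exists i.
have D'0 : ~: D != set0 by apply/set0Pn; exists j.
have sub : [set~ a] \subset inner setT D :|: inner setT (~: D).
  apply/subsetP => b ba; have /eqP/cards2P [k [l [_ eb]]] := simpleT b.
  rewrite !inE eb !subUset !sub1set /=.
  have [kD|kD] := boolP (k \in D); first by rewrite (stD _ _ _ ba eb kD).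
  have: l \in ~: D by apply: stable_setC ba eb _; [| rewrite inE].
  by rewrite inE => lD; rewrite inE kD lD.
have := leq_trans (subset_leq_card sub) (leq_card_setU _ _).
have := tree_inner D0; have := tree_inner D'0; have := cardsC D.
rewrite cardsC1 !card_ord; have := ltn_ord a.
move: #|inner _ D| #|inner _ _| #|D| #|~: D| => x y p q; lia.
Qed.

(** The edge a is the first one on the path from i to j.  It exists because i and
    the sides away from i of the edges at i form a stable set.  It is unique
    because the intersection of two such sides is stable and avoids i, hence is
    empty. *)
Lemma tree_separator i j : i != j ->
  exists a, forall b, (i \in ends T b) && (j \notin component T [set~ b] i) = (b == a).
Proof.
move=> ij; pose W b := ~: component T [set~ b] i.
have stW b c k l : ends T c = [set k; l] -> c != b -> k \in W b -> l \in W b.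
  by move=> e cb; apply: stable_setC e; [apply: component_stable | rewrite !inE].
have iW b : i \notin W b by rewrite inE component_refl.
pose S := [set k | (k == i) || [exists b, (i \in ends T b) && (k \in W b)]].
have S_full : S = setT.
  apply: (@stableT_full _ i); last by rewrite inE eqxx.
  move=> c k l _ e; rewrite !inE => /orP [/eqP ki|/existsP [b /andP [ib kW]]].
    apply/orP; right; apply/existsP; exists c; rewrite e ki set21 inE.
    by rewrite ki in e; apply: tree_bridge.
  have [E|cb] := eqVneq c b; last first.
    by apply/orP; right; apply/existsP; exists b; rewrite ib (stW _ _ _ _ e).
  move: ib; rewrite -E e => /set2P [ik|->]; last by rewrite eqxx.
  by case/negP: (iW b); rewrite ik.
have /existsP [a /andP [ia jWa]] : [exists b, (i \in ends T b) && (j \in W b)].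
  have: j \in S by rewrite S_full inE.
  by rewrite inE eq_sym (negPf ij).
exists a => b; apply/andP/eqP => [[ib jb]|->]; last by rewrite ia; move: jWa; rewrite inE.
apply/eqP; apply: contraT => ba.
have jW : j \in W a :&: W b by apply/setIP; split=> //; rewrite in_setC.
(* the end of c other than i is on the side of i of d, as c joins it to i *)
have out c d k l : ends T c = [set k; l] -> i \in ends T c -> c != d ->
    k \in W c -> k \in W d -> False.
  move=> e ic cd kc kd; have ik : i != k by apply: contraNneq (iW c) => ->.
  have il : l = i by move: ic; rewrite e !inE (negPf ik) /= => /eqP.
  by case/negP: (iW d); rewrite -il; apply: stW e cd kd.
suff E : W a :&: W b = setT.
  have: i \in W a :&: W b by rewrite E inE.
  by rewrite inE (negPf (iW a)).
apply: (@stableT_full _ j) => // c k l _ e /setIP [ka kb].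
have [E|ca] := eqVneq c a.
  by subst c; case: (out a b k l e ia) => //; rewrite eq_sym.
have [E|cb] := eqVneq c b; first by subst c; case: (out b a k l e ib).
by rewrite inE (stW a c k l) // (stW b c k l).
Qed.

(** By [tree_separator] the sides away from i of the edges at i partition the nodes
    other than i. *)
Lemma sum_opposite_sides (F : nmodType) (d : 'I_t -> F) i :
  \sum_(a | i \in ends T a) \sum_(j in ~: component T [set~ a] i) d j
  = \sum_(j | j != i) d j.
Proof.
under eq_bigr => a _ do rewrite big_mkcond.
rewrite exchange_big [RHS]big_mkcond /=; apply: eq_bigr => j _.
rewrite -big_mkcondr /=; case: eqVneq => [->|ji].
  by rewrite big_pred0 // => a; rewrite inE component_refl andbF.
rewrite eq_sym in ji; have [a aP] := tree_separator ji.
by rewrite (big_pred1 a) // => b; rewrite inE aP.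
Qed.

(** Here h j b is a value attached to the end j of the edge b.  An edge inside D is
    counted at both ends, and a at its end i only. *)
Lemma sum_half_edges (F : zmodType) (h : 'I_t -> 'I_t.-1 -> F) (c : F) a i :
  (forall b k l, ends T b = [set k; l] -> h k b + h l b = c) ->
  i \in ends T a ->
  let D := component T [set~ a] i in
  \sum_(j in D) \sum_(b | j \in ends T b) h j b = h i a + c *+ (#|D|.-1).
Proof.
move=> hc ia D; have [j ji e] := endsE ia.
have iD : i \in D by apply: component_refl.
have jD : j \notin D by rewrite tree_bridge.
have stD : stable [set~ a] D by apply: component_stable.
have cardD : (#|inner setT D| = #|D|.-1)%N by rewrite -(card_inner_side ia).
clearbody D; under eq_bigr => k _ do rewrite big_mkcond.
rewrite exchange_big (bigD1 a) //=; congr (_ + _).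
  rewrite (bigD1 i) //= ia big1 ?addr0 // => k /andP [kD ki].
  by rewrite e !inE (negPf ki) /=; case: eqP => // kj; rewrite -kj kD in jD.
rewrite -cardD -sumr_const [RHS]big_mkcond [RHS](bigD1 a) //=.
rewrite inE in_setT e subUset !sub1set (negPf jD) andbF add0r.
apply: eq_bigr => b ba; have /eqP/cards2P [k [l [kl eb]]] := simpleT b.
have bA : b \in [set~ a] by rewrite !inE.
have kDl : (k \in D) = (l \in D).
  apply/idP/idP; first exact: stD eb.
  by apply: stD; [exact: bA | rewrite eb setUC].
rewrite -big_mkcondr inE in_setT eb subUset !sub1set /= -kDl andbb.
case: ifP => kD; last first.
  rewrite big_pred0 // => m; apply/andP => -[+ /set2P [] E].
    by rewrite E kD.
  by rewrite E -kDl kD.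
rewrite (bigD1 k) /= ?kD ?set21 // (big_pred1 l) ?(hc b) // => m.
rewrite !inE /=; case: (eqVneq m k) => [->|mk] /=; first by rewrite (negPf kl) !andbF.
by rewrite andbT; case: (eqVneq m l) => [->|]; rewrite ?andbF // -kDl kD.
Qed.

Lemma sum_half_edgesT (F : zmodType) (h : 'I_t -> 'I_t.-1 -> F) (c : F) :
  (forall b k l, ends T b = [set k; l] -> h k b + h l b = c) ->
  \sum_j \sum_(b | j \in ends T b) h j b = c *+ t.-1.
Proof.
move=> hc; under eq_bigr => k _ do rewrite big_mkcond.
rewrite exchange_big /= -[X in _ *+ X]card_ord -sumr_const; apply: eq_bigr => b _.
have /eqP/cards2P [k [l [kl eb]]] := simpleT b.
rewrite -big_mkcond eb (bigD1 k) ?inE ?eqxx //= (big_pred1 l) ?(hc b) // => m.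
by rewrite !inE; case: (eqVneq m k) => [->|] //=; rewrite ?(negPf kl) ?andbF ?andbT.
Qed.
End Graph.

(** * Random bases *)

Section RandomBases.
Variables (F : realFieldType) (V : finType).
Implicit Types (N : matroid V) (w : {set V} -> F) (z : V -> F) (e p : V).

Definition distribution N w :=
  (forall B, 0 <= w B) /\ \sum_(B in bases N) w B = 1.

Definition marginal N w e := \sum_(B in bases N | e \in B) w B.

Lemma basis_ground N B : B \in bases N -> B \subset ground N.
Proof. by have /and3P [_ /forall_inP sub _] := matroidP N; apply: sub. Qed.

Lemma sum_indicator (A B : {set V}) : \sum_(e in A) (e \in B)%:R = #|A :&: B|%:R :> F.
Proof.
rewrite -sum1_card natr_sum (eq_bigl (fun e => (e \in A) && (e \in B))).
  by rewrite [RHS]big_mkcondr; apply: eq_bigr => e _; case: (e \in B).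
by move=> e; rewrite inE.
Qed.

Lemma marginal_ge0 N w e : distribution N w -> 0 <= marginal N w e.
Proof. by case=> w0 _; apply: sumr_ge0. Qed.

Lemma marginalC N w e : distribution N w ->
  \sum_(B in bases N | e \notin B) w B = 1 - marginal N w e.
Proof. by case=> _ <-; apply/eqP; rewrite eq_sym subr_eq addrC -bigID. Qed.

Section Uniform.
Variable G : {set V}.

Definition fractional z := [set e in G | (z e != 0) && (z e != 1)].

(** Moving weight from j to i until one of the two coordinates becomes integral. *)
Lemma fractional_shift z i j :
  (forall e, e \in G -> 0 <= z e <= 1) -> i != j ->
  i \in fractional z -> j \in fractional z ->
  exists d, let y := fun e => z e + d * ((e == i)%:R - (e == j)%:R) in
  [/\ 0 < d, forall e, e \in G -> 0 <= y e <= 1,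
      \sum_(e in G) y e = \sum_(e in G) z e &
      (#|fractional y| < #|fractional z|)%N].
Proof.
move=> box ij; rewrite !inE => /and3P [iG zi0 zi1] /and3P [jG zj0 zj1].
have [/andP [i_ge i_le] /andP [j_ge j_le]] := (box i iG, box j jG).
exists (Num.min (1 - z i) (z j)) => y; set d := Num.min _ _ in y *.
have yE e : y e = if e == i then z i + d else if e == j then z j - d else z e.
  rewrite /y; case: eqVneq => [->|_]; first by rewrite (negPf ij) /=; ring.
  by case: eqVneq => [->|_] /=; ring.
have d_gt0 : 0 < d.
  by rewrite lt_min subr_gt0 !lt_neqAle zi1 i_le eq_sym zj0 j_ge.
have [d_i d_j] : d <= 1 - z i /\ d <= z j by rewrite !ge_min !lexx orbT.
split=> //.
- move=> e eG; rewrite yE; case: eqP => _; first by apply/andP; split; lra.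
  by case: eqP => _; [apply/andP; split; lra | apply: box].
- rewrite /y big_split /= -mulr_sumr sumrB.
  have sum1 k : k \in G -> \sum_(e in G) (e == k)%:R = 1 :> F.
    by move=> kG; rewrite (bigD1 k) //= eqxx big1 ?addr0 // => e /andP [_ /negPf ->].
  by rewrite !sum1 // subrr mulr0 addr0.
- apply: proper_card; rewrite properE; apply/andP; split.
    apply/subsetP => e; rewrite !inE yE => /andP [-> /=].
    case: (eqVneq e i) => [->|_]; first by rewrite zi0 zi1.
    by case: (eqVneq e j) => [->|_] //; rewrite zj0 zj1.
  have [le|lt] := leP (1 - z i) (z j).
    apply/subsetPn; exists i; rewrite !inE ?iG ?zi0 ?zi1 // yE eqxx.
    by rewrite /d min_l // addrC subrK eqxx andbF.
  apply/subsetPn; exists j; rewrite !inE ?jG ?zj0 ?zj1 // yE (eq_sym j) (negPf ij) eqxx.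
  by rewrite /d min_r ?ltW // subrr eqxx.
Qed.

(** Integrality of the hypersimplex, by induction on the number of fractional
    coordinates.  As the sum is an integer, a single coordinate cannot be
    fractional; given two of them, shifting weight in both directions writes z as
    a convex combination of two vectors with fewer fractional coordinates. *)
Lemma uniform_marginals N n k z :
  ground N = G -> is_uniform N n k ->
  (forall e, e \in G -> 0 <= z e <= 1) -> \sum_(e in G) z e = k%:R ->
  exists2 w, distribution N w & forall e, e \in G -> marginal N w e = z e.
Proof.
move=> gN [_ bN].
have [m] := ubnP #|fractional z|; elim: m z => // m IHm z cz box sumz.
have [frac0|[i iz]] := set_0Vmem (fractional z).
  pose B0 := [set e in G | z e == 1].
  have zE e : e \in G -> z e = (e \in B0)%:R.
    move=> eG; rewrite inE eG /=; case: (eqVneq (z e) 1) => [->//|z1].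
    apply/eqP; apply: contraT => z0; have: e \in fractional z by rewrite inE eG z0 z1.
    by rewrite frac0 inE.
  have B0G : B0 \subset G by apply/subsetP => e; rewrite inE => /andP [].
  have B0N : B0 \in bases N.
    rewrite bN inE gN B0G /= -(eqr_nat F) -sumz (eq_bigr _ zE).
    by rewrite sum_indicator (setIidPr B0G).
  exists (fun B => (B == B0)%:R).
    split=> [B|]; first exact: ler0n.
    by rewrite (bigD1 B0) //= eqxx big1 ?addr0 // => B /andP [_ /negPf ->].
  move=> e eG; rewrite zE // /marginal; have [eB|eB] := boolP (e \in B0).
    by rewrite (bigD1 B0) /= ?B0N // eqxx big1 ?addr0 // => B /andP [_ /negPf ->].
  by rewrite big1 // => B /andP [_ eB']; case: eqP => // BB0; rewrite -BB0 eB' in eB.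
have [iG zi0 zi1] : [/\ i \in G, z i != 0 & z i != 1].
  by move: iz; rewrite inE => /and3P.
have [j ij jz] : exists2 j, i != j & j \in fractional z.
  have [/exists_inP [j jz ij]|none] := boolP [exists j in fractional z, i != j].
    by exists j.
  have zE e : e \in G -> e != i -> z e = (z e == 1)%:R.
    move=> eG ei; case: (eqVneq (z e) 1) => [->//|z1]; apply/eqP; apply: contraR none => z0.
    by apply/exists_inP; exists e; rewrite ?inE ?eG ?z0 // eq_sym.
  have /andP [i_ge i_le] := box i iG.
  move: sumz; rewrite (bigD1 i) //= (eq_bigr (fun e => (z e == 1)%:R)); last first.
    by move=> e /andP [eG ei]; apply: zE.
  rewrite -natr_sum; set s := (\sum_(e in G | _) _)%N => sumz.
  have: s%:R < k%:R :> F by rewrite -sumz ltrDr lt_neqAle eq_sym zi0.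
  have: k%:R < s.+1%:R :> F.
    by rewrite -sumz -natr1 addrC ltrD2l lt_neqAle zi1.
  by rewrite !ltr_nat; lia.
have ji : j != i by rewrite eq_sym.
have [d /= [d_gt0 ybox ysum ycard]] := fractional_shift box ij iz jz.
have [d' /= [d'_gt0 y'box y'sum y'card]] := fractional_shift box ji jz iz.
have [w [w0 w1] wy] := IHm _ (leq_trans ycard (ltnSE cz)) ybox (etrans ysum sumz).
have [w' [w'0 w'1] wy'] := IHm _ (leq_trans y'card (ltnSE cz)) y'box (etrans y'sum sumz).
have dd_gt0 : 0 < d + d' by rewrite addr_gt0.
(* the weights for which the shifts by d and - d' cancel *)
pose c := d' / (d + d'); pose c' := d / (d + d').
exists (fun B => c * w B + c' * w' B).
  split=> [B|].
    by rewrite addr_ge0 // mulr_ge0 // divr_ge0 // ltW.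
  rewrite big_split /= -!mulr_sumr w1 w'1 !mulr1 -mulrDl addrC divff //.
  exact: lt0r_neq0.
move=> e eG; rewrite /marginal big_split /= -!mulr_sumr.
have := wy e eG; have := wy' e eG; rewrite /marginal => -> ->.
rewrite /c /c'; field; exact: lt0r_neq0.
Qed.

End Uniform.

(** Joint law of a random basis B1 and a basis B2 drawn conditionally on
    containing p exactly when B1 does not.  Here q1 and q2 are the probabilities
    of p in B1 and of p in B2; when q1 + q2 = 1, the conditioning event p notin B2
    has probability q1, whence the denominators. *)
Definition coupling p w1 w2 (q1 q2 : F) (B1 B2 : {set V}) : F :=
  if (p \in B1) (+) (p \in B2)
  then w1 B1 * w2 B2 / (if p \in B1 then q1 else q2) else 0.

Lemma coupling_sym p w1 w2 q1 q2 B1 B2 :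
  coupling p w1 w2 q1 q2 B1 B2 = coupling p w2 w1 q2 q1 B2 B1.
Proof.
by rewrite /coupling addbC (mulrC (w1 _)); case: (p \in B1); case: (p \in B2).
Qed.

Lemma coupling_marginal N1 N2 w1 w2 p B1 :
  distribution N1 w1 -> distribution N2 w2 ->
  marginal N1 w1 p + marginal N2 w2 p = 1 -> B1 \in bases N1 ->
  \sum_(B2 in bases N2) coupling p w1 w2 (marginal N1 w1 p) (marginal N2 w2 p) B1 B2
  = w1 B1.
Proof.
move=> D1 D2; set q1 := marginal N1 w1 p; set q2 := marginal N2 w2 p => q12 B1N.
(* when q = 0, w1 B1 = 0 too, so the convention x / 0 = 0 does no harm *)
have cancel q : (q = 0 -> w1 B1 = 0) -> w1 B1 * q / q = w1 B1.
  by move=> H; have [q0|q0] := eqVneq q 0; [rewrite H ?mul0r | rewrite mulfK].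
have [w1_ge0 _] := D1; rewrite /coupling -big_mkcondr /=; case: ifP => pB1.
  rewrite -mulr_suml -mulr_sumr -[RHS](cancel q1).
    by rewrite -(eqP (_ : 1 - q2 == q1)) ?marginalC //; apply/eqP; lra.
  move=> q0; move: q0; rewrite /q1 /marginal => /psumr_eq0P; apply => //.
  by rewrite B1N.
rewrite -mulr_suml -mulr_sumr -[RHS](cancel q2) // => q0.
have: \sum_(B in bases N1 | p \notin B) w1 B = 0 by rewrite marginalC -/q1 //; lra.
by move/psumr_eq0P; apply => //; rewrite B1N pB1.
Qed.

(** The random basis is B1 u B2 minus p for a pair (B1, B2) drawn from the coupling. *)
Lemma two_sum_distribution N N1 N2 p w1 w2 :
  bases N = [set (B1 :|: B2) :\ p | B1 in bases N1, B2 in bases N2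
               & (p \in B1) (+) (p \in B2)] ->
  distribution N1 w1 -> distribution N2 w2 ->
  marginal N1 w1 p + marginal N2 w2 p = 1 ->
  exists2 w, distribution N w & forall e, e != p ->
    (e \notin ground N2 -> marginal N w e = marginal N1 w1 e) /\
    (e \notin ground N1 -> marginal N w e = marginal N2 w2 e).
Proof.
move=> bN D1 D2 q12; set q1 := marginal N1 w1 p; set q2 := marginal N2 w2 p.
have [[w1_ge0 _] [w2_ge0 _]] := (D1, D2).
pose g := coupling p w1 w2 q1 q2.
have g_ge0 B1 B2 : 0 <= g B1 B2.
  rewrite /g /coupling; case: ifP => // _; rewrite divr_ge0 ?mulr_ge0 //.
  by case: ifP => _; apply: marginal_ge0.
have g1 B1 : B1 \in bases N1 -> \sum_(B2 in bases N2) g B1 B2 = w1 B1.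
  exact: coupling_marginal.
have g2 B2 : B2 \in bases N2 -> \sum_(B1 in bases N1) g B1 B2 = w2 B2.
  move=> B2N; under eq_bigr => B1 _ do rewrite /g coupling_sym.
  by apply: coupling_marginal => //; rewrite addrC.
pose j (B1 B2 : {set V}) := (B1 :|: B2) :\ p.
pose w B := \sum_(B1 in bases N1) \sum_(B2 in bases N2 | j B1 B2 == B) g B1 B2.
have sumw (f : pred {set V}) : \sum_(B in bases N | f B) w B =
    \sum_(B1 in bases N1) \sum_(B2 in bases N2 | f (j B1 B2)) g B1 B2.
  rewrite /w exchange_big /=; apply: eq_bigr => B1 B1N.
  under eq_bigr => B _ do rewrite big_mkcondr.
  rewrite exchange_big big_mkcondr /=; apply: eq_bigr => B2 B2N.
  rewrite -big_mkcondr /=; case: ifP => fj; last first.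
    by rewrite big_pred0 // => B; case: eqVneq => [<-|]; rewrite ?fj ?andbF.
  have [jN|jN] := boolP (j B1 B2 \in bases N).
    by rewrite (big_pred1 (j B1 B2)) // => B; rewrite /= eq_sym;
      case: eqVneq => [->|]; rewrite ?jN ?fj ?andbF.
  rewrite big_pred0; last by move=> B; case: eqVneq => [<-|]; rewrite ?(negPf jN) ?andbF.
  rewrite /g /coupling; case: ifP => // x; case/negP: jN; rewrite bN.
  by apply/imset2P; exists B1 B2; rewrite // inE B2N x.
exists w.
  split=> [B|]; first by apply: sumr_ge0 => B1 _; apply: sumr_ge0.
  have := sumw predT; rewrite (eq_bigl (mem (bases N))) => [->|B]; last by rewrite andbT.
  case: D1 => _ <-; apply: eq_bigr => B1 B1N; rewrite -g1 //.
  by apply: eq_bigl => B2; rewrite andbT.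
move=> e ep; rewrite /marginal sumw; split=> eN.
  rewrite [RHS]big_mkcondr; apply: eq_bigr => B1 B1N.
  under eq_bigl => B2.
    rewrite !inE ep /=; over.
  case: ifP => eB1; first by rewrite -g1 //; apply: eq_bigl => B2; rewrite andbT.
  rewrite big_pred0 // => B2; apply/andP => -[/basis_ground/subsetP/(_ e) eB eB2].
  by rewrite eB in eN.
rewrite (exchange_big_dep (mem (bases N2))) /=; last by move=> B1 B2 _ /andP [].
rewrite [RHS]big_mkcondr; apply: eq_bigr => B2 B2N.
under eq_bigl => B1 do rewrite !inE ep B2N /=.
case: ifP => eB2; first by rewrite -g2 //; apply: eq_bigl => B1; rewrite orbT andbT.
rewrite big_pred0 // => B1; rewrite orbF; apply/andP => -[/basis_ground/subsetP/(_ e) eB eB1].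
by rewrite eB in eN.
Qed.

End RandomBases.

(** * Contracting the tree *)

Section TreeStructure.
Variables (F : realFieldType) (V : finType) (M : matroid V) (t : nat).
Variables (T : edge_labeled_graph V t) (U : 'I_t -> matroid V) (n k : 'I_t -> nat).
Hypothesis uniformU : forall j, is_uniform (U j) (n j) (k j).
Hypothesis treeT : tree_structure T M U.
Implicit Types (a b : 'I_t.-1) (i j : 'I_t) (C : {set 'I_t}) (e : V).

Lemma card_ends a : #|ends T a| = 2.
Proof. by have [[_ [simple _] _ _] _ _ _ _] := treeT; apply: simple. Qed.

Lemma tree_connected : graph_connected T setT.
Proof. by have [[]] := treeT. Qed.

Lemma tree_no_triangle i j l :
  adj T setT i j -> adj T setT j l -> adj T setT l i -> False.
Proof.
have neq x y : adj T setT x y -> x != y.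
  by case/adjP=> a _ /(ends_neq card_ends).
have [[_ _ _ acyclic] _ _ _ _] := treeT => ij jl li.
have := acyclic [:: i; j; l]; rewrite /ucycle /= ij jl li !inE negb_or.
by rewrite (neq _ _ ij) (neq _ _ jl) eq_sym (neq _ _ li) => /(_ isT).
Qed.

Lemma common_adj i j e :
  i != j -> e \in ground (U i) -> e \in ground (U j) -> adj T setT i j.
Proof.
move=> ij ei ej; have [_ _ _ [_ disj] _] := treeT.
by apply: contraT => /(disj _ _ ij) /disjointFr /(_ ei); rewrite ej.
Qed.

Lemma label_ends a i j : ends T a = [set i; j] ->
  ground (U i) :&: ground (U j) = [set label T a].
Proof. by have [_ _ _ [inter _] _] := treeT; apply: inter. Qed.

(** Otherwise the node j and the two ends of a would be pairwise adjacent, because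
    they share the label of a. *)
Lemma label_in a j : (label T a \in ground (U j)) = (j \in ends T a).
Proof.
have ends_in l : l \in ends T a -> label T a \in ground (U l).
  case/(endsE card_ends) => m _ /label_ends /setP /(_ (label T a)).
  by rewrite !inE eqxx => /andP [].
apply/idP/idP => [aj|]; last exact: ends_in.
have /eqP/cards2P [x [y [xy e]]] := card_ends a.
have [ax ay] : label T a \in ground (U x) /\ label T a \in ground (U y).
  by split; apply: ends_in; rewrite e ?set21 ?set22.
apply: contraT; rewrite e !inE negb_or => /andP [jx jy].
by case: (@tree_no_triangle x j y); apply: (common_adj (e := label T a)) => //; rewrite eq_sym.
Qed.

Lemma label_inj : injective (label T).
Proof.
have [[_ [_ ends_inj] _ _] _ _ _ _] := treeT => a b ab; apply: ends_inj.
by apply/setP => j; rewrite -!label_in ab.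
Qed.

Lemma label_notin a : label T a \notin ground M.
Proof.
have [_ _ [disj _] _ _] := treeT; apply/negP => /(disjointFr disj).
by rewrite imset_f.
Qed.

Lemma ground_node e : e \in ground M -> exists j, e \in ground (U j).
Proof.
have [_ _ [_ cover] _ _] := treeT => eM.
have: e \in \bigcup_j ground (U j) by rewrite cover inE eM.
by case/bigcupP => j _; exists j.
Qed.

Lemma node_ground e j : e \in ground (U j) ->
  e \notin ground M -> exists a, e = label T a.
Proof.
have [_ _ [_ cover] _ _] := treeT => ej.
have: e \in \bigcup_j ground (U j) by apply/bigcupP; exists j.
by rewrite cover inE => /orP [->//|/imsetP [a _ ->]]; exists a.
Qed.

Lemma node_unique e i j : e \in ground M ->
  e \in ground (U i) -> e \in ground (U j) -> i = j.
Proof.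
move=> eM ei ej; apply/eqP; apply: contraT => ij.
have /adjP [a _ /label_ends /setP /(_ e)] := common_adj ij ei ej.
rewrite !inE ei ej => /esym/eqP ea.
by move: (label_notin a); rewrite -ea eM.
Qed.

(** The nodes of T that form one vertex with j once the edges b < m are contracted. *)
Definition stage m j := component T [set b : 'I_t.-1 | (b < m)%N] j.

Lemma stage0 j : stage 0 j = [set j].
Proof. by rewrite -(component_set0 T) /stage; congr component. Qed.

Lemma stageS a i j l : ends T a = [set i; j] ->
  let C := stage a i :|: stage a j in
  stage a.+1 l = if l \in C then C else stage a l.
Proof.
move=> e C; have := componentU1 [set b : 'I_t.-1 | (b < a)%N] l e.
rewrite (_ : a |: _ = [set b : 'I_t.-1 | (b < a.+1)%N]) //.
by apply/setP => b; rewrite !inE ltnS [RHS]leq_eqVlt -val_eqE.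
Qed.

Lemma stage_last j : stage t.-1 j = setT.
Proof.
apply/setP => i; rewrite !inE; rewrite (_ : [set b | _] = setT).
  exact: tree_connected.
by apply/setP => b; rewrite !inE ltn_ord.
Qed.

(** At the contraction of the edge a, the two vertices at its ends are merged and
    all others remain. *)
Lemma contraction_ind (Q : nat -> {set 'I_t} -> Prop) :
  (forall j, Q 0 [set j]) ->
  (forall a i j, ends T a = [set i; j] -> Q a (stage a i) -> Q a (stage a j) ->
     Q a.+1 (stage a i :|: stage a j)) ->
  (forall a j, [disjoint ends T a & stage a j] -> Q a (stage a j) ->
     Q a.+1 (stage a j)) ->
  forall m j, (m <= t.-1)%N -> Q m (stage m j).
Proof.
move=> Q0 Qmerge Qkeep; elim=> [|m IHm] l; first by rewrite stage0.
move=> lt_m; pose a := Ordinal lt_m.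
have /eqP/cards2P [i [j [_ e]]] := card_ends a.
rewrite -[m]/(nat_of_ord a) (stageS _ e); case: ifP => lC.
  by apply: Qmerge => //; apply: IHm; apply: ltnW.
apply: Qkeep; last by apply: IHm; apply: ltnW.
rewrite e disjoint_sym disjoints_subset; apply/subsetP => x xl.
rewrite !inE; apply: contraFN lC => /orP [] /eqP E; apply/setUP; [left|right];
  by rewrite /stage component_mem_sym -E.
Qed.

Lemma stage_disjoint a i j : ends T a = [set i; j] ->
  [disjoint stage a i & stage a j].
Proof.
move=> e; have sub l : stage a l \subset component T [set~ a] l.
  apply: component_sub_stable; last exact: component_refl.
  move=> b x y; rewrite inE => ba eb; apply: component_stable eb.
  by rewrite !inE -val_eqE /= neq_ltn ba.
apply: disjointWl (sub i) _; apply: disjointWr (sub j) _.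
by rewrite (tree_cut tree_connected e) disjoints_subset setCK.
Qed.

Lemma stage_edge m b i j l : (b < m)%N -> ends T b = [set i; j] ->
  (i \in stage m l) = (j \in stage m l).
Proof.
move=> bm e; have bA : b \in [set b : 'I_t.-1 | (b < m)%N] by rewrite inE.
apply/idP/idP; first exact: component_stable e.
by apply: component_stable; [exact: bA | rewrite e setUC].
Qed.

Variable L : {set 'I_t} -> matroid V.
Hypothesis L1 : forall j, L [set j] = U j.
Hypothesis L2 : forall a i j, ends T a = [set i; j] ->
  is_two_sum (L (stage a i :|: stage a j)) (L (stage a i)) (L (stage a j)).

(** The element at which [is_two_sum] glues is existentially quantified; it has to
    be the label of a, the only common element of the two matroids. *)
Lemma merge_label a i j : ends T a = [set i; j] ->
  label T a \in ground (L (stage a i)) -> label T a \in ground (L (stage a j)) ->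
  [/\ ground (L (stage a i)) :&: ground (L (stage a j)) = [set label T a],
      ~~ loop (L (stage a i)) (label T a) /\ ~~ coloop (L (stage a i)) (label T a),
      ground (L (stage a i :|: stage a j))
      = (ground (L (stage a i)) :|: ground (L (stage a j))) :\ label T a &
      bases (L (stage a i :|: stage a j))
      = [set (B1 :|: B2) :\ label T a | B1 in bases (L (stage a i)),
             B2 in bases (L (stage a j)) & (label T a \in B1) (+) (label T a \in B2)]].
Proof.
move=> e ai aj; have [p [inter nl _ gE bE]] := L2 e.
have /set1P ap : label T a \in [set p] by rewrite -inter inE ai.
by rewrite ap; split.
Qed.

Definition contracted m := label T @: [set b : 'I_t.-1 | (b < m)%N].

Lemma contractedS a : contracted a.+1 = label T a |: contracted a.
Proof.
rewrite /contracted -imsetU1 (_ : a |: _ = [set b : 'I_t.-1 | (b < a.+1)%N]) //.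
apply/setP => b; by rewrite !inE ltnS [RHS]leq_eqVlt -val_eqE.
Qed.

Lemma label_contracted a m : (label T a \in contracted m) = (a < m)%N.
Proof. by rewrite mem_imset ?inE //; apply: label_inj. Qed.

Lemma stage_ground m l : (m <= t.-1)%N ->
  ground (L (stage m l)) = (\bigcup_(i in stage m l) ground (U i)) :\: contracted m.
Proof.
pose Q m C := ground (L C) = (\bigcup_(i in C) ground (U i)) :\: contracted m.
apply: (contraction_ind (Q := Q)) => {m l} [j|a i j e Qi Qj|a j disj Qj].
- rewrite /Q L1 big_set1 (_ : contracted 0 = set0) ?setD0 //.
  by apply/setP => x; rewrite [RHS]inE; apply/imsetP => -[b]; rewrite inE.
- have la l : l \in ends T a -> Q a (stage a l) -> label T a \in ground (L (stage a l)).
    move=> lE ->; rewrite inE label_contracted ltnn.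
    by apply/bigcupP; exists l; [apply: component_refl | rewrite label_in].
  have ia : i \in ends T a by rewrite e set21.
  have ja : j \in ends T a by rewrite e set22.
  have [_ _ gE _] := merge_label e (la i ia Qi) (la j ja Qj).
  by rewrite /Q gE Qi Qj contractedS bigcup_setU -setDUl setDDl [contracted a :|: _]setUC.
rewrite /Q Qj contractedS; apply/setP => x; rewrite !in_setD in_setU1.
have [->|//] := eqVneq x (label T a); rewrite label_contracted ltnn /=.
apply/bigcupP => -[i ij]; rewrite label_in => /(disjointFr disj).
by rewrite ij.
Qed.

Lemma stage_ground_in m l i e : (m <= t.-1)%N -> i \in stage m l ->
  e \in ground (U i) -> (e \in ground (L (stage m l))) = (e \notin contracted m).
Proof.
move=> mt il ei; rewrite stage_ground // in_setD andbC.
by rewrite (_ : e \in _) //; apply/bigcupP; exists i.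
Qed.

Lemma label_stage a i : i \in ends T a -> label T a \in ground (L (stage a i)).
Proof.
move=> ia; rewrite (@stage_ground_in _ _ i) ?label_in //.
- by rewrite label_contracted ltnn.
- exact/ltnW/ltn_ord.
- exact: component_refl.
Qed.

(** The two matroids share only the label of a, which the 2-sum deletes, so the
    element comes from the one that contains the node l. *)
Lemma merge_sides a i j l e : ends T a = [set i; j] ->
  l \in stage a i -> e \in ground (U l) ->
  e \in ground (L (stage a i :|: stage a j)) ->
  [/\ e \in ground (L (stage a i)), e \notin ground (L (stage a j)) & e != label T a].
Proof.
move=> ends_a li el.
have ai : label T a \in ground (L (stage a i)) by rewrite label_stage // ends_a set21.
have aj : label T a \in ground (L (stage a j)) by rewrite label_stage // ends_a set22.
have at1 : (a <= t.-1)%N by apply/ltnW/ltn_ord.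
have [/setP /(_ e) inter _ -> _] := merge_label ends_a ai aj.
rewrite in_setD1 in_setU => /andP [ea eij].
have ei : e \in ground (L (stage a i)).
  rewrite (stage_ground_in at1 li el).
  by case/orP: eij; rewrite stage_ground // in_setD => /andP [].
by split=> //; move: inter; rewrite !inE ei (negPf ea) /= => ->.
Qed.

(** B arises from bases Z i of the nodes in C that satisfy the exclusive-or
    condition of the 2-sum at each contracted edge. *)
Definition node_bases m C (B : {set V}) (Z : 'I_t -> {set V}) :=
  [/\ forall i, i \in C -> Z i \in bases (U i),
      forall i e, i \in C -> e \in ground (U i) -> e \in ground (L C) ->
        (e \in Z i) = (e \in B) &
      forall b i j, (b < m)%N -> ends T b = [set i; j] -> i \in C ->
        (label T b \in Z i) (+) (label T b \in Z j)].

Lemma stage_decompose m l B : (m <= t.-1)%N ->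
  B \in bases (L (stage m l)) -> exists Z, node_bases m (stage m l) B Z.
Proof.
pose Q m C := forall B, B \in bases (L C) -> exists Z, node_bases m C B Z.
move=> mt; move: m l mt B.
apply: (contraction_ind (Q := Q)) => [j B|a i j e Qi Qj B|a j disj Qj B].
- rewrite L1 => BU; exists (fun _ => B); split=> // i /set1P -> //.
- have [at1 ai aj] : [/\ (a <= t.-1)%N, label T a \in ground (L (stage a i)) &
    label T a \in ground (L (stage a j))].
  by split; [apply/ltnW/ltn_ord | |]; rewrite label_stage // e ?set21 ?set22.
  have [inter _ gE ->] := merge_label e ai aj.
  have disj := stage_disjoint e.
  case/imset2P => B1 B2 B1N; rewrite inE => /andP [B2N xor] ->.
  have [[Z1 [Z1b Z1e Z1x]] [Z2 [Z2b Z2e Z2x]]] := (Qi B1 B1N, Qj B2 B2N).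
  have outj x : x \in stage a j -> x \in stage a i = false by move/(disjointFl disj).
  exists (fun x => if x \in stage a i then Z1 x else Z2 x); split.
  + by move=> x /setUP [xi|xj]; [rewrite xi; apply: Z1b | rewrite outj //; apply: Z2b].
  + move=> x y xC yx yg; move: (xC); rewrite in_setU; case: ifP => /= [xi _|_ xj].
      have [y1 y2 ya] := merge_sides e xi yx yg.
      rewrite Z1e // !inE ya /=; case: (y \in B1) => //=.
      by apply/esym; apply: contraNF y2; apply/subsetP/basis_ground.
    have e' : ends T a = [set j; i] by rewrite e setUC.
    have := merge_sides e' xj yx; rewrite setUC => /(_ yg) [y2 y1 ya].
    rewrite Z2e // !inE ya /= orbC; case: (y \in B2) => //=.
    by apply/esym; apply: contraNF y1; apply/subsetP/basis_ground.
  + move=> b x y; rewrite ltnS leq_eqVlt => /orP [/eqP/val_inj -> e' _|ba e' xC].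
      have iT : (label T a \in Z1 i) = (label T a \in B1).
        by apply: Z1e; rewrite ?component_refl ?label_in // e set21.
      have jT : (label T a \in Z2 j) = (label T a \in B2).
        by apply: Z2e; rewrite ?component_refl ?label_in // e set22.
      have ij := ends_neq card_ends e'.
      have ii : i \in stage a i by apply: component_refl.
      have jj : j \in stage a i = false by apply: outj; apply: component_refl.
      have: x \in [set i; j] by rewrite -e e' set21.
      have: y \in [set i; j] by rewrite -e e' set22.
      case/set2P => yE /set2P [] xE; move: ij; rewrite xE yE ?eqxx // => _.
        by rewrite ii jj jT iT addbC.
      by rewrite ii jj jT iT.
    rewrite -(stage_edge _ ba e'); move: xC; rewrite in_setU.
    by case: ifP => [xi _|_ /= xj]; [apply: Z1x e' xi | apply: Z2x e' xj].
move=> /Qj [Z [Zb Ze Zx]]; exists Z; split=> // b x y.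
rewrite ltnS leq_eqVlt => /orP [/eqP/val_inj -> e' xj|]; last exact: Zx.
by have := disjointFl disj xj; rewrite e' set21.
Qed.

(** The converse of [stage_decompose], for marginals instead of bases: random bases
    of the nodes whose marginals fit at every edge are coupled into a random
    basis of the contracted matroid. *)
Lemma stage_compose (z : 'I_t -> V -> F) m l :
  (forall i e, e \in ground (U i) -> 0 <= z i e <= 1) ->
  (forall i, \sum_(e in ground (U i)) z i e = (k i)%:R) ->
  (forall b i j, ends T b = [set i; j] -> z i (label T b) + z j (label T b) = 1) ->
  (m <= t.-1)%N ->
  exists2 w, distribution (L (stage m l)) w &
    forall i e, i \in stage m l -> e \in ground (U i) ->
      e \in ground (L (stage m l)) -> marginal (L (stage m l)) w e = z i e.
Proof.
move=> box sumz xor.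
pose Q (m : nat) C := exists2 w, distribution (L C) w &
    forall i e, i \in C -> e \in ground (U i) ->
      e \in ground (L C) -> marginal (L C) w e = z i e.
apply: (contraction_ind (Q := Q)) => {m l} [j|a i j e [w1 D1 w1z] [w2 D2 w2z]|a j _] //.
  have [w D wz] := uniform_marginals (erefl (ground (U j))) (uniformU j) (box j) (sumz j).
  by exists w; rewrite L1 // => i e /set1P -> eU _; apply: wz.
have ai : label T a \in ground (L (stage a i)) by rewrite label_stage // e set21.
have aj : label T a \in ground (L (stage a j)) by rewrite label_stage // e set22.
have [inter _ gE bE] := merge_label e ai aj.
have q12 : marginal (L (stage a i)) w1 (label T a)
    + marginal (L (stage a j)) w2 (label T a) = 1.
  rewrite (w1z i) ?(w2z j) ?component_refl ?label_in ?e ?set21 ?set22 //.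
  exact: xor.
have [w D wz] := two_sum_distribution bE D1 D2 q12.
exists w => // x y /setUP [xi|xj] yx yg.
  have [y1 y2 ya] := merge_sides e xi yx yg.
  by rewrite (wz y ya).1 //; apply: w1z.
have e' : ends T a = [set j; i] by rewrite e setUC.
have := merge_sides e' xj yx; rewrite setUC => /(_ yg) [y2 y1 ya].
by rewrite (wz y ya).2 //; apply: w2z.
Qed.

(** The label of a is neither a loop nor a coloop of the matroid at the end i of a
    when a is contracted, so U i has a basis that contains it and one that does
    not. *)
Lemma uniform_nontrivial a i : i \in ends T a -> (0 < k i < #|ground (U i)|)%N.
Proof.
move=> ia; have [j _ e] := endsE card_ends ia.
have ai := label_stage ia.
have aj : label T a \in ground (L (stage a j)) by rewrite label_stage // e set22.
have [_ [nl nc] _ _] := merge_label e ai aj.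
have at1 : (a <= t.-1)%N by apply/ltnW/ltn_ord.
have node (B : {set V}) : B \in bases (L (stage a i)) -> exists2 Z : {set V},
    (Z \subset ground (U i)) && (#|Z| == k i) & (label T a \in Z) = (label T a \in B).
  case/(stage_decompose at1) => Z [Zb Ze _]; exists (Z i).
    by have := Zb i (component_refl _ _ _); rewrite (uniformU i).2 inE.
  by apply: Ze; rewrite ?component_refl ?label_in.
apply/andP; split.
  move: nl; rewrite /loop ai negb_forall_in => /exists_inP [B /node [Z]].
  by case/andP=> _ /eqP <- <-; rewrite negbK => aZ; apply/card_gt0P; exists (label T a).
move: nc; rewrite /coloop ai negb_forall_in => /exists_inP [B /node [Z]].
case/andP=> ZU /eqP <- <- aZ; apply: proper_card; rewrite properE ZU /=.
by apply/subsetPn; exists (label T a); rewrite ?label_in.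
Qed.
End TreeStructure.

(** * Node families *)

Section Families.
Variables (F : realFieldType) (V : finType) (M : matroid V) (t : nat).
Variables (T : edge_labeled_graph V t) (U : 'I_t -> matroid V) (n k : 'I_t -> nat).
Hypothesis uniformU : forall j, is_uniform (U j) (n j) (k j).
Hypothesis treeT : tree_structure T M U.
Implicit Types (a b : 'I_t.-1) (i j : 'I_t) (C : {set 'I_t}) (e : V).

(** A fractional version of a choice of bases of all nodes that can be glued along
    all edges. *)
Definition node_family (z : 'I_t -> V -> F) :=
  [/\ forall i e, e \in ground (U i) -> 0 <= z i e <= 1,
      forall i, \sum_(e in ground (U i)) z i e = (k i)%:R &
      forall b i j, ends T b = [set i; j] -> z i (label T b) + z j (label T b) = 1].

Lemma tree_contraction : exists L : {set 'I_t} -> matroid V,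
  [/\ forall j, L [set j] = U j,
      forall a i j, ends T a = [set i; j] ->
        is_two_sum (L (stage T a i :|: stage T a j)) (L (stage T a i)) (L (stage T a j)) &
      L setT = M].
Proof. by have [_ _ _ _ [L [L1 L2 L3]]] := treeT; exists L. Qed.

Lemma node0 : exists i : 'I_t, stage T t.-1 i = setT.
Proof.
have [[t_gt0 _ _ _] _ _ _ _] := treeT; exists (Ordinal t_gt0).
exact: stage_last treeT _.
Qed.

Lemma basis_family (B : {set V}) : B \in bases M -> exists2 Z : 'I_t -> {set V},
  node_family (fun i e => (e \in Z i)%:R) &
  forall i e, e \in ground (U i) -> e \in ground M -> (e \in Z i) = (e \in B).
Proof.
have [L [L1 L2 <-]] := tree_contraction; have [i0 i0T] := node0.
rewrite -i0T => /(stage_decompose treeT L1 L2 (leqnn _)) [Z []].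
rewrite i0T => Zb Ze Zx; exists Z => [|i e]; last by apply: Ze; rewrite in_setT.
split=> [i e _|i|b i j e].
- by case: (e \in Z i); rewrite ?lexx ?ler01.
- rewrite sum_indicator; congr _%:R; have := Zb i (in_setT _).
  by rewrite (uniformU i).2 inE => /andP [/setIidPr -> /eqP].
have := Zx b i j (ltn_ord b) e (in_setT _).
by case: (_ \in Z i); case: (_ \in Z j) => // _; rewrite ?addr0 ?add0r.
Qed.

Lemma family_distribution z : node_family z ->
  exists2 w, distribution M w &
  forall i e, e \in ground (U i) -> e \in ground M -> marginal M w e = z i e.
Proof.
have [L [L1 L2 <-]] := tree_contraction; have [i0 i0T] := node0; case=> box sumz xor.
have := stage_compose uniformU treeT L1 L2 i0 box sumz xor (leqnn t.-1).
by rewrite i0T => -[w D wz]; exists w => // i e; apply: wz; rewrite in_setT.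
Qed.

Lemma node_nontrivial a i : i \in ends T a -> (0 < k i < #|ground (U i)|)%N.
Proof.
by have [L [L1 L2 _]] := tree_contraction; apply: (uniform_nontrivial uniformU treeT L1 L2).
Qed.

Definition own i := ground (U i) :&: ground M.

(** Every element of M belongs to exactly one node. *)
Lemma sum_side (X : V -> F) C :
  \sum_(e in side M U C) X e = \sum_(i in C) \sum_(e in own i) X e.
Proof.
under [RHS]eq_bigr => i _ do rewrite big_mkcond.
rewrite [RHS]exchange_big [LHS]big_mkcond /=; apply: eq_bigr => e _.
rewrite -big_mkcondr /= inE; have [eM|eM] /= := boolP (e \in ground M); last first.
  by rewrite big_pred0 // => i; rewrite in_setI (negPf eM) !andbF.
case: ifP => [/exists_inP [i iC ei]|none].
  rewrite (big_pred1 i) // => j; rewrite in_setI eM andbT /=.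
  by apply/andP/eqP => [[_ /(node_unique treeT eM)]|->//]; apply.
rewrite big_pred0 // => i; rewrite in_setI eM andbT; apply: contraFF none.
by case/andP=> iC ei; apply/exists_inP; exists i.
Qed.

Lemma sideT : side M U setT = ground M.
Proof.
apply/setP => e; rewrite inE; case eM: (e \in ground M) => //=.
by have [i ei] := ground_node treeT eM; apply/exists_inP; exists i; rewrite ?in_setT.
Qed.

Lemma sum_node (z : V -> F) i :
  \sum_(e in ground (U i)) z e
  = \sum_(e in own i) z e + \sum_(b | i \in ends T b) z (label T b).
Proof.
rewrite (big_setID (ground M)) /=; congr (_ + _).
transitivity (\sum_(b in [set b | i \in ends T b]) z (label T b)); last first.
  by apply: eq_bigl => b; rewrite inE.
rewrite -(big_imset z (in2W (label_inj treeT))); apply: eq_bigl => e.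
rewrite in_setD; apply/andP/imsetP => [[eM eU]|[b]].
  have [b eb] := node_ground treeT eU eM; exists b => //.
  by rewrite inE -(label_in treeT) -eb.
by rewrite inE -(label_in treeT) => bi ->; rewrite (label_notin treeT).
Qed.

(** Sum the equations of the nodes in D; the labels contribute 1 for each of the
    |D| - 1 edges inside D, and z i (label T a) for the edge a. *)
Lemma sum_family_side z X a i : node_family z ->
  (forall j e, e \in own j -> X e = z j e) -> i \in ends T a ->
  let D := component T [set~ a] i in
  \sum_(e in side M U D) X e
  = \sum_(j in D) (k j)%:R - (#|D|.-1)%:R - z i (label T a).
Proof.
move=> [_ sumz xor] Xz ia D.
have := sum_half_edges (card_ends treeT) (tree_connected treeT) xor ia.
rewrite -/D => half; rewrite sum_side.
under [in RHS]eq_bigr => j _ do rewrite -sumz sum_node.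
rewrite big_split /= half.
under [LHS]eq_bigr => j _ do rewrite (eq_bigr _ (Xz j)).
ring.
Qed.

Lemma sum_family_ground z X : node_family z ->
  (forall j e, e \in own j -> X e = z j e) ->
  \sum_(e in ground M) X e = \sum_j (k j)%:R - t.-1%:R.
Proof.
move=> [_ sumz xor] Xz; have half := sum_half_edgesT (card_ends treeT) xor.
rewrite -sideT sum_side (eq_bigl predT) => [|j]; last by rewrite inE.
under [in RHS]eq_bigr => j _ do rewrite -sumz sum_node.
rewrite big_split /= half.
under [LHS]eq_bigr => j _ do rewrite (eq_bigr _ (Xz j)).
ring.
Qed.

(** Spreading the rest of the sum evenly over the other elements stays in [0, 1]
    because 0 < k i < |E(U i)|. *)
Lemma node_vector i a (c : F) : i \in ends T a -> 0 <= c <= 1 ->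
  exists f : V -> F, [/\ f (label T a) = c,
    forall e, e \in ground (U i) -> 0 <= f e <= 1 &
    \sum_(e in ground (U i)) f e = (k i)%:R].
Proof.
move=> ia /andP [c_ge c_le]; have /andP [k_gt k_lt] := node_nontrivial ia.
have ai : label T a \in ground (U i) by rewrite (label_in treeT).
have [m mE] : exists m, #|ground (U i)| = m.+1.
  by exists #|ground (U i)|.-1; rewrite prednK //; lia.
have m_gt : 0 < m%:R :> F by rewrite ltr0n; lia.
exists (fun e => if e == label T a then c else ((k i)%:R - c) / m%:R).
have k1 : 1 <= (k i)%:R :> F by rewrite ler1n.
have km : (k i)%:R <= m%:R :> F by rewrite ler_nat; lia.
split=> [|e _|]; first by rewrite eqxx.
  case: eqP => _; first by rewrite c_ge.
  by rewrite divr_ge0 ?ler_pdivrMr ?ler0n ?mul1r //; lra.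
rewrite (big_setD1 _ ai) /= eqxx (eq_bigr (fun=> ((k i)%:R - c) / m%:R)); last first.
  by move=> e; rewrite in_setD1 => /andP [/negPf ->].
rewrite sumr_const; have -> : #|ground (U i) :\ label T a| = m.
  by have := cardsD1 (label T a) (ground (U i)); rewrite ai mE => -[].
by rewrite -[_ *+ m]mulr_natr mulfVK ?lt0r_neq0 // addrC subrK.
Qed.

(** The family is built outward from i, starting with the value 0 at a: each new
    node is joined to the previous ones by a single edge, and [node_vector] allows
    to prescribe the value there. *)
Lemma family_avoiding a i : i \in ends T a ->
  exists2 z, node_family z & z i (label T a) = 0.
Proof.
move=> ia.
pose P (S : {set 'I_t}) := (#|inner T setT S|.+1 = #|S|)%N /\ exists z : 'I_t -> V -> F,
  [/\ i \in S, z i (label T a) = 0,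
    forall j, j \in S -> (forall e, e \in ground (U j) -> 0 <= z j e <= 1) /\
                         \sum_(e in ground (U j)) z j e = (k j)%:R &
    forall b j l, ends T b = [set j; l] -> j \in S -> l \in S ->
      z j (label T b) + z l (label T b) = 1].
suff [_ [z [_ za zS zx]]] : P setT.
  exists z => //; split=> [j|j|b j l e]; last by apply: zx => //; rewrite in_setT.
    by have [] := zS j (in_setT j).
  by have [] := zS j (in_setT j).
have i0 : [set i] != set0 by apply/set0Pn; exists i; rewrite inE.
apply: (grow (P := P) (tree_connected treeT) i0).
  split.
    by have := tree_inner (tree_connected treeT) i0; rewrite cards1; lia.
  have [f [fa fbox fsum]] := node_vector (c := 0) ia (introT andP (conj (lexx 0) ler01)).
  exists (fun _ => f); split=> [||j /set1P ->|b j l e /set1P ji /set1P li] //.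
    exact: set11.
  by have := ends_neq (card_ends treeT) e; rewrite ji li eqxx.
move=> S b s j _ e sS jS [cardS [z [iS za zS zx]]].
have S'0 : j |: S != set0 by apply/set0Pn; exists j; rewrite setU11.
have cardS' : (#|j |: S| = #|S|.+1)%N by rewrite cardsU1 jS.
have lt1 := inner_grow (in_setT b) e sS jS.
have lt2 := tree_inner (tree_connected treeT) S'0.
have jb : j \in ends T b by rewrite e set22.
have sb : s \in ends T b by rewrite e set21.
have [zs_box _] := zS s sS.
have /andP [zs_ge zs_le] : 0 <= z s (label T b) <= 1.
  by apply: zs_box; rewrite (label_in treeT).
have c01 : 0 <= 1 - z s (label T b) <= 1 by apply/andP; split; lra.
have [f [fb fbox fsum]] := node_vector jb c01.
(* a second edge from j to S would give j |: S as many inner edges as nodes *)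
have only c l : ends T c = [set j; l] -> l \in S -> c = b /\ l = s.
  move=> ec lS; have [cb|cb] := eqVneq c b.
    split=> //; have: l \in [set s; j] by rewrite -e -cb ec set22.
    by case/set2P => // lj; rewrite -lj lS in jS.
  have c_out : c \notin b |: inner T setT S.
    by rewrite !inE negb_or cb ec subUset !sub1set (negPf jS).
  have b_out : b \notin inner T setT S.
    by rewrite !inE e subUset !sub1set (negPf jS) andbF.
  have sub : c |: (b |: inner T setT S) \subset inner T setT (j |: S).
    apply/subsetP => d /setU1P [->|/setU1P [->|]]; rewrite !inE /=.
    - by rewrite ec subUset !sub1set !inE eqxx lS orbT.
    - by rewrite e subUset !sub1set !inE eqxx sS orbT.
    by move/subset_trans; apply; apply: subsetUr.
  have := leq_ltn_trans (subset_leq_card sub) lt2.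
  by rewrite cardsU1 c_out cardsU1 b_out cardS' -cardS ltnn.
split.
  apply/eqP; rewrite cardS' eqSS eqn_leq; apply/andP; split; last by rewrite -cardS.
  by rewrite cardS' in lt2.
exists (fun l => if l == j then f else z l).
have notj l : l \in S -> (l == j) = false by move=> lS; apply: contraNF jS => /eqP <-.
split=> [||l /setU1P [->|lS]|c l m ec /setU1P [lj|lS] /setU1P [mj|mS]].
- by rewrite inE iS orbT.
- by rewrite notj.
- by rewrite eqxx.
- by rewrite notj //; apply: zS.
- by have := ends_neq (card_ends treeT) ec; rewrite lj mj eqxx.
- rewrite lj in ec *; have [-> ->] := only c m ec mS.
  by rewrite eqxx notj // fb subrK.
- rewrite mj in ec *; rewrite setUC in ec; have [-> ->] := only c l ec lS.
  by rewrite eqxx notj // fb addrC subrK.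
by rewrite !notj //; apply: zx ec lS mS.
Qed.

(** Let d j = 1 - k j + x(own j).  The slack of the inequality of a side is 1 minus
    the sum of d over this side, which is the sum of d over the other side since
    d sums to 1 by the equation for x(E).  So the value at the end i of an edge a
    is the sum of d over the side of a away from i.  For the equation at a node i,
    these sides partition the nodes other than i ([sum_opposite_sides]), hence
    the values at i add up to 1 - d i = k i - x(own i). *)
Lemma family_of_point (X : V -> F) :
  (forall e, e \in ground M -> 0 <= X e <= 1) ->
  \sum_(e in ground M) X e = \sum_j (k j)%:R - t.-1%:R ->
  (forall a i, i \in ends T a ->
     \sum_(e in side M U (component T [set~ a] i)) X e
     <= \sum_(j in component T [set~ a] i) (k j)%:R
        - (#|component T [set~ a] i|.-1)%:R) ->
  exists2 z, node_family z & forall j e, e \in own j -> X e = z j e.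
Proof.
move=> box total sides.
pose d j := 1 - (k j)%:R + \sum_(e in own j) X e.
have sumd C : \sum_(j in C) d j
    = #|C|%:R - \sum_(j in C) (k j)%:R + \sum_(e in side M U C) X e.
  by rewrite /d big_split sumrB /= -sum_side sumr_const.
have sumdT : \sum_j d j = 1.
  rewrite -(eq_bigl _ _ (in_setT (T := _))) sumd sideT total cardsT card_ord.
  have [[t_gt0 _ _ _] _ _ _ _] := treeT; rewrite -{1}(prednK t_gt0) -natr1.
  rewrite (eq_bigl predT) => [|j]; last by rewrite inE.
  ring.
have sum_le1 a i : i \in ends T a -> \sum_(j in component T [set~ a] i) d j <= 1.
  move=> ia; have := sides a i ia; set D := component _ _ _; rewrite sumd.
  have D_gt0 : (0 < #|D|)%N by apply/card_gt0P; exists i; apply: component_refl.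
  have -> : #|D|%:R = (#|D|.-1)%:R + 1 :> F by rewrite natr1 prednK.
  lra.
pose v (a : 'I_t.-1) i := \sum_(j in ~: component T [set~ a] i) d j.
have vE a i : v a i = 1 - \sum_(j in component T [set~ a] i) d j.
  rewrite -sumdT [in RHS](bigID (mem (component T [set~ a] i))) /= addrAC subrr add0r.
  by apply: eq_bigl => j; rewrite in_setC.
have v_sum a i j : ends T a = [set i; j] -> v a i + v a j = 1.
  move=> e; rewrite vE /v.
  rewrite (tree_cut (tree_connected treeT) e) setCK; ring.
have v_ge0 a i : i \in ends T a -> 0 <= v a i by move=> ia; rewrite vE subr_ge0 sum_le1.
pose z j e := if e \in ground M then X e else
  if [pick a | label T a == e] is Some a then v a j else 0.
have z_label j a : z j (label T a) = v a j.
  rewrite /z (negPf (label_notin treeT a)); case: pickP => [b /eqP/(label_inj treeT) -> //|].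
  by move/(_ a); rewrite eqxx.
have z_own j e : e \in own j -> X e = z j e.
  by rewrite inE /z => /andP [_ ->].
exists z => //; split=> [i e ei|i|b i j e].
- have [eM|eM] := boolP (e \in ground M); first by rewrite /z eM; apply: box.
  have [a ea] := node_ground treeT ei eM; rewrite ea z_label.
  rewrite ea (label_in treeT) in ei; rewrite v_ge0 //=.
  have [j _ ends_a] := endsE (card_ends treeT) ei.
  by rewrite -(v_sum a i j ends_a) lerDl v_ge0 // ends_a set22.
- rewrite sum_node -(eq_bigr _ (z_own i)).
  under [X in _ + X]eq_bigr => b _ do rewrite z_label.
  rewrite (sum_opposite_sides (tree_connected treeT)).
  have := sumdT; rewrite (bigD1 i) //= /d; lra.
by rewrite !z_label; apply: v_sum.
Qed.
End Families.

(** * Ranks *)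

Section Rank.
Variables (F : realFieldType) (V : finType) (M : matroid V).

Lemma leq_card_basis_rk (B S : {set V}) : B \in bases M -> (#|B :&: S| <= rk M S)%N.
Proof.
move=> BM; apply: leq_bigmax_cond; rewrite subsetIr /=.
by apply/exists_inP; exists B => //; apply: subsetIl.
Qed.

Lemma rk_basis (S : {set V}) : exists2 B, B \in bases M & rk M S = #|B :&: S|.
Proof.
have /and3P [/set0Pn [B0 B0M] _ _] := matroidP M.
have indep0 : (set0 \subset S) && independent M set0.
  by rewrite sub0set /=; apply/exists_inP; exists B0; rewrite ?sub0set.
have [|I /andP [IS /exists_inP [B BM IB]] rkI] := @eq_bigmax_cond _
  [pred I : {set V} | (I \subset S) && independent M I] (fun I : {set V} => #|I|).
  by apply/card_gt0P; exists set0.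
exists B => //; apply/eqP; rewrite eqn_leq leq_card_basis_rk // andbT.
rewrite {1}/rk [X in (X <= _)%N]rkI; apply: subset_leq_card.
by rewrite subsetI IB.
Qed.

Lemma sum_marginal (w : {set V} -> F) (S : {set V}) :
  \sum_(e in S) marginal M w e = \sum_(B in bases M) w B * #|B :&: S|%:R.
Proof.
rewrite /marginal; under eq_bigr => e _ do rewrite big_mkcondr.
rewrite exchange_big /=; apply: eq_bigr => B _.
rewrite setIC -sum_indicator mulr_sumr; apply: eq_bigr => e _.
by case: (e \in B); rewrite ?mulr1 ?mulr0.
Qed.

Lemma sum_marginal_le_rk (w : {set V} -> F) (S : {set V}) :
  distribution M w -> \sum_(e in S) marginal M w e <= (rk M S)%:R.
Proof.
move=> [w0 w1]; rewrite sum_marginal.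
have -> : (rk M S)%:R = \sum_(B in bases M) w B * (rk M S)%:R :> F.
  by rewrite -mulr_suml w1 mul1r.
by apply: ler_sum => B BM; apply: ler_wpM2l => //; rewrite ler_nat leq_card_basis_rk.
Qed.
End Rank.

Section RankFormula.
Variables (F : realFieldType) (V : finType) (M : matroid V) (t : nat).
Variables (T : edge_labeled_graph V t) (U : 'I_t -> matroid V) (n k : 'I_t -> nat).
Hypothesis uniformU : forall j, is_uniform (U j) (n j) (k j).
Hypothesis treeT : tree_structure T M U.
Implicit Types (a b : 'I_t.-1) (i j : 'I_t) (C : {set 'I_t}) (e : V).



Lemma basis_own (B : {set V}) (Z : 'I_t -> {set V}) :
  (forall i e, e \in ground (U i) -> e \in ground M -> (e \in Z i) = (e \in B)) ->
  forall j e, e \in own M U j -> (e \in B)%:R = (e \in Z j)%:R :> F.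
Proof. by move=> ZB j e /setIP [eU eM]; rewrite ZB. Qed.

Lemma card_basis (B : {set V}) : B \in bases M ->
  #|B|%:R = \sum_j (k j)%:R - t.-1%:R :> F.
Proof.
move=> BM; have [Z famZ ZB] := basis_family F uniformU treeT BM.
rewrite -(sum_family_ground treeT famZ (basis_own ZB)) sum_indicator.
by rewrite (setIidPr (basis_ground BM)).
Qed.

Lemma rk_ground : (rk M (ground M))%:R = \sum_j (k j)%:R - t.-1%:R :> F.
Proof.
have [B BM ->] := rk_basis M (ground M).
by rewrite (setIidPl (basis_ground BM)) card_basis.
Qed.

(** The upper bound holds for each basis because the value at a is nonnegative.  For
    the lower bound, a random basis made from a family with value 0 at a has as
    expected number of elements on the side exactly the right-hand side. *)
Lemma rk_side a i : i \in ends T a -> let D := component T [set~ a] i in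
  (rk M (side M U D))%:R = \sum_(j in D) (k j)%:R - (#|D|.-1)%:R :> F.
Proof.
move=> ia D; apply/eqP; rewrite eq_le; apply/andP; split.
  have [B BM ->] := rk_basis M (side M U D).
  have [Z famZ ZB] := basis_family F uniformU treeT BM.
  rewrite setIC -sum_indicator (sum_family_side treeT famZ (basis_own ZB) ia).
  by rewrite gerBl ler0n.
have [z famz za] := family_avoiding F uniformU treeT ia.
have [w Dw wz] := family_distribution uniformU treeT famz.
have own_z j e : e \in own M U j -> marginal M w e = z j e.
  by case/setIP; apply: wz.
have := sum_marginal_le_rk (side M U D) Dw.
by rewrite (sum_family_side treeT famz own_z ia) za subr0.
Qed.
End RankFormula.

(* Imported only here because classical_sets redefines finset names. *)
From mathcomp Require Import classical_sets reals.

(** * The base polytope *)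

Section Polytope.
Variables (R : realType) (V : finType) (M : matroid V).
Implicit Types (x : {ffun elt M -> R^o}) (S B : {set V}).

(** Extension by 0 to all of V, so that sums run over plain sets of V. *)
Definition extend x (e : V) : R := oapp x 0 (insub e).

Lemma extend_val x (e : elt M) : extend x (val e) = x e.
Proof. by rewrite /extend valK. Qed.

Lemma coord_sum_extend x S : S \subset ground M ->
  coord_sum x S = \sum_(e in S) extend x e.
Proof.
move=> SM; rewrite /coord_sum -(eq_bigr _ (fun e _ => extend_val x e)).
rewrite -(big_sub_cond (ground M) (fun e => e \in S) (extend x)); apply: eq_bigl => e /=.
by rewrite andbC; case: (boolP (e \in S)) => // eS; rewrite (fintype.subsetP SM e eS).
Qed.

Lemma coord_sum_charvec B S : S \subset ground M ->
  coord_sum (charvec R M B) S = #|B :&: S|%:R.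
Proof.
move=> SM; rewrite coord_sum_extend // finset.setIC -sum_indicator.
apply: eq_bigr => e eS; have eM := fintype.subsetP SM e eS.
by rewrite -[e in LHS]/(val (Sub e eM : elt M)) extend_val ffunE.
Qed.

(** Bounds that hold for the characteristic vectors pass to convex combinations. *)
Lemma coord_sum_bounds x S (lo hi : nat) : S \subset ground M -> base_polytope R M x ->
  (forall B, B \in bases M -> lo <= #|B :&: S| <= hi)%N ->
  lo%:R <= coord_sum x S <= hi%:R.
Proof.
move=> SM [m [p [w [pB w0 w1 ->]]]] bounds.
have -> : coord_sum (\sum_i w i *: p i) S = \sum_i w i * coord_sum (p i) S.
  rewrite /coord_sum; under eq_bigr => e _ do rewrite sum_ffunE.
  rewrite exchange_big /=; apply: eq_bigr => i _; rewrite mulr_sumr.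
  by apply: eq_bigr => e _; rewrite ffunE.
have pb i : lo%:R <= coord_sum (p i) S <= hi%:R.
  have [B BM ->] := pB i; rewrite coord_sum_charvec // !ler_nat; exact: bounds.
have avg (c : R) : c = \sum_i w i * c by rewrite -mulr_suml w1 mul1r.
rewrite [lo%:R]avg [hi%:R]avg.
by apply/andP; split; apply: ler_sum => i _; rewrite ler_wpM2l //; have /andP [] := pb i.
Qed.

Lemma distribution_base_polytope (w : {set V} -> R) x :
  distribution M w -> (forall e, x e = marginal M w (val e)) -> base_polytope R M x.
Proof.
move=> [w0 w1] xw.
exists #|bases M|, (fun i => charvec R M (enum_val i)), (fun i => w (enum_val i)).
split=> [i|i||] //.
- by exists (enum_val i) => //; apply: enum_valP.
- by rewrite -w1 [RHS]big_enum_val.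
apply/ffunP => e; rewrite sum_ffunE xw /marginal big_mkcondr /= big_enum_val.
apply: eq_bigr => i _; rewrite !ffunE.
by case: ifP => _; rewrite /GRing.scale /= ?mulr1 ?mulr0.
Qed.
End Polytope.

Theorem theorem29 (R : realType) (V : finType) (M : matroid V) (t : nat)
    (U : 'I_t -> matroid V) (n k : 'I_t -> nat) (T : edge_labeled_graph V t) :
  matroid_connected M ->
  two_level (base_polytope R M) ->
  (forall j, is_uniform (U j) (n j) (k j)) ->
  tree_structure T M U ->
  base_polytope R M =
    [set x : {ffun elt M -> R^o} |
      [/\ forall e, 0 <= (x e : R),
          forall e, (x e : R) <= 1,
          coord_sum x (ground M) = (rk M (ground M))%:R &
          forall (a : 'I_t.-1) (C : {set 'I_t}), C \in components_without T a ->
            coord_sum x (side M U C) <= (rk M (side M U C))%:R]]%classic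
  /\
  (forall (a : 'I_t.-1) (C : {set 'I_t}), C \in components_without T a ->
     (rk M (side M U C))%:Z = 1 - #|C|%:Z + \sum_(j in C) (k j)%:Z).
Proof.
move=> _ _ uniformU treeT.
have side_sub C : side M U C \subset ground M.
  by apply/fintype.subsetP => e; rewrite inE => /andP [].
have componentP a C : C \in components_without T a ->
    exists2 i, i \in ends T a & C = component T [set~ a] i.
  have /eqP/cards2P [i [j [_ e]]] := card_ends treeT a.
  case/finset.imsetP => l _ ->.
  have [li|li] := boolP (l \in component T [set~ a] i).
    by exists i; rewrite ?e ?set21 // (component_mem li).
  exists j; rewrite ?e ?set22 //; apply: component_mem.
  by rewrite (tree_cut (tree_connected treeT) e) finset.in_setC.
split; last first.
  move=> a C /componentP [i ia ->]; set D := component T _ i.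
  have cardD : (0 < #|D|)%N by apply/card_gt0P; exists i; apply: component_refl.
  have := rk_side rat uniformU treeT ia; rewrite -/D => rkD.
  apply/eqP; rewrite -(eqr_int rat) rmorphD rmorphB rmorph_sum /=.
  rewrite -[(rk _ _)%:~R]/((rk M (side M U D))%:R) rkD.
  have -> : #|D|%:~R = (#|D|.-1)%:R + 1 :> rat by rewrite natr1 prednK.
  apply/eqP; ring.
apply/seteqP; split=> x.
  move=> Px; have bounds := coord_sum_bounds _ Px.
  have x01 e : 0 <= x e <= 1.
    have eM : [set val e]%SET \subset ground M by rewrite finset.sub1set (valP e).
    have := bounds _ 0 1 eM; rewrite coord_sum_extend // big_set1 extend_val; apply.
    by move=> B _; rewrite (leq_trans (subset_leq_card (finset.subsetIr _ _))) ?cards1.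
  split=> [e|e||a C _].
  - by have /andP [] := x01 e.
  - by have /andP [] := x01 e.
  - apply/eqP; rewrite eq_le andbC; apply: bounds => // B BM.
    rewrite (finset.setIidPl (basis_ground BM)).
    have -> : #|B| = rk M (ground M); last by rewrite leqnn.
    apply/eqP; rewrite -(eqr_nat R) (card_basis _ uniformU treeT BM).
    by rewrite (rk_ground _ uniformU treeT).
  have /andP [] // : 0%:R <= coord_sum x (side M U C) <= (rk M (side M U C))%:R.
  by apply: bounds => // B BM; rewrite leq_card_basis_rk.
case=> x0 x1 xE xC.
have box e : e \in ground M -> 0 <= extend x e <= 1.
  by move=> eM; rewrite -[e]/(val (Sub e eM : elt M)) extend_val x0 x1.
have [||z famz xz] := family_of_point treeT (k := k) box.
- by rewrite -coord_sum_extend // xE (rk_ground _ uniformU treeT).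
- move=> a i ia; rewrite -coord_sum_extend // -(rk_side _ uniformU treeT ia).
  by apply: (xC a); apply: imset_f.
have [w Dw wz] := family_distribution uniformU treeT famz.
apply: (distribution_base_polytope Dw) => e; have [i ei] := ground_node treeT (valP e).
rewrite (wz i) ?(valP e) // -xz ?extend_val //.
by rewrite finset.in_setI ei (valP e).
Qed.
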